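(* Let $g(x)=\alpha x^{q^k}+\beta x$ with $\alpha\in\mathbb{F}_{q^n}^*$, $\beta\in\mathbb{F}_{q^n}$, $1\le k<n$, let $f(y)=a_dy^{q^d}$ with $a_d\in\mathbb{F}_{q^n}^*$, $0\le d<n$, and let $0\le h<n$ with $h\ne d$. (1) If $\beta=0$, then $L_g\cap L_f\ne\emptyset$ if and only if $\mathrm{N}_{q^n/q^e}(a_d/\alpha)=1$, where $e=\gcd(n,k,d-h)$. (2) If $\beta\neq0$ and $k+|d-h|\le n/2$, then $L_g\cap L_f\neq\emptyset$.
   Context: Let $q$ be a prime power, $n\ge2$. For $e\mid n$, $\mathrm{N}_{q^n/q^e}(x)=x^{(q^n-1)/(q^e-1)}$; $\gcd$ is taken positive. For $q$-polynomials $g,f$ over $\mathbb{F}_{q^n}$ and an integer $0\le h<n$: $L_g=\{\langle(x,g(x))\rangle_{\mathbb{F}_{q^n}}:x\in\mathbb{F}_{q^n}^*\}$ and $L_f=\{\langle(y^{q^h},f(y))\rangle_{\mathbb{F}_{q^n}}:y\in\mathbb{F}_{q^n}^*\}$, points of $\mathrm{PG}(1,q^n)$. *)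

(* Defs.v *)
From HB Require Import structures.
From mathcomp Require Import all_boot all_order all_algebra.
Set Implicit Arguments. Unset Strict Implicit. Unset Printing Implicit Defensive.
Import GRing.Theory.
Local Open Scope ring_scope.

(* The finite field F = F_{q^n} is modelled by a finFieldType F with #|F| = q^n. *)

(* The point <v>_{F} of PG(1,F) spanned by v in F^2, as the set of F-multiples of v. *)
Definition pt (F : finFieldType) (v : F * F) : {set F * F} :=
  [set (c * v.1, c * v.2) | c : F].

Definition Lg (F : finFieldType) (g : F -> F) : {set {set F * F}} :=
  [set pt (x, g x) | x in [pred x : F | x != 0]].

Definition Lf (F : finFieldType) (q h : nat) (f : F -> F) : {set {set F * F}} :=
  [set pt (y ^+ (q ^ h), f y) | y in [pred y : F | y != 0]].

Definition normqn (F : finFieldType) (q n e : nat) (x : F) : F :=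
  x ^+ ((q ^ n).-1 %/ (q ^ e).-1).

Definition absdiff (d h : nat) : nat := ((d - h) + (h - d))%N.

(* Main.v *)
(** Equality of points turns the intersection condition into the solvability of
    [alpha * u ^+ (q ^ k - 1) + beta = ad * z ^+ (q ^ s - 1)] with [u, z != 0]
    and [s = |d - h|].  For [beta = 0] this asks whether [ad / alpha] is a
    product of a [(q ^ k - 1)]-th and a [(q ^ s - 1)]-th power in the cyclic
    group [F^*].

    For [beta != 0], a second moment replaces the Hasse-Weil bound.  Let [H]
    and [K] be the subgroups of [A]-th and [B]-th powers, of indices [A] and
    [B], and send [x], distinct from [0] and [-beta], to the pair of cosets
    [(x H, (x + beta) K)].  Two distinct elements [x], [y] with the same image
    are determined by [(x / y, (x + beta) / (y + beta))], a pair of nontrivial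
    elements of [H] and [K]; so there are few collisions, and by Cauchy-Schwarz
    all [A * B] pairs of cosets are attained as soon as
    [(A * B) * (A * B - 1) < #|F| - 2]. *)
Require Import Defs.
From HB Require Import structures.
From mathcomp Require Import all_boot all_order all_algebra.
From mathcomp Require Import cyclic finfield zify ring.
Import GRing.Theory.
Local Open Scope ring_scope.

(** * Cauchy-Schwarz and collisions of a map *)

Lemma sqr_sum_le_card_mul (I : finType) (S : {set I}) (N : I -> nat) :
  ((\sum_(i in S) N i) ^ 2 <= #|S| * \sum_(i in S) N i ^ 2)%N.
Proof.
(* After doubling, both sides are sums over pairs [(i, j)], compared termwise by 2ab <= a^2 +
   b^2. *)
rewrite -(leq_pmul2l (ltn0Sn 1)).
have -> : (2 * (\sum_(i in S) N i) ^ 2 =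
           \sum_(i in S) \sum_(j in S) 2 * (N i * N j))%N.
  rewrite -mulnn big_distrlr big_distrr /=; apply: eq_bigr => i _.
  by rewrite big_distrr.
have -> : (2 * (#|S| * \sum_(i in S) N i ^ 2) =
           \sum_(i in S) \sum_(j in S) (N i ^ 2 + N j ^ 2))%N.
  under [RHS]eq_bigr do rewrite big_split /= sum_nat_const.
  by rewrite big_split /= -big_distrr /= sum_nat_const mul2n addnn.
by apply: leq_sum => i _; apply: leq_sum => j _; apply: nat_Cauchy.
Qed.

(** The fibre sizes sum to [#|A|] and their squares to the number of colliding pairs, diagonal
    included. *)
Lemma sqr_card_le_collisions (I J : finType) (f : I -> J) (A : {set I}) :
  (#|A| ^ 2 <= #|f @: A| * #|[set z in setX A A | f z.1 == f z.2]|)%N.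
Proof.
have -> : #|A| = (\sum_(j in f @: A) #|[set i in A | f i == j]|)%N.
  rewrite -sum1_card (partition_big_imset f); apply: eq_bigr => j _.
  by rewrite sum1dep_card.
have -> : #|[set z in setX A A | f z.1 == f z.2]| =
          (\sum_(j in f @: A) #|[set i in A | f i == j]| ^ 2)%N.
  rewrite -sum1_card (partition_big (fun z => f z.1) (mem (f @: A))) /=.
    apply: eq_bigr => j _; rewrite sum1dep_card -mulnn -cardsX.
    apply: eq_card => -[x y]; rewrite !inE /=.
    case: (f x =P j) => [->|_]; last by rewrite !andbF.
    by rewrite !andbT (eq_sym j) andbA.
  by move=> [x y]; rewrite !inE => /andP[/andP[xA _] _]; apply: imset_f.
exact: sqr_sum_le_card_mul.
Qed.

(** * Powers and roots of unity in the cyclic group F^* *)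

Lemma card_unity_roots_le (F : finFieldType) (m : nat) :
  (0 < m)%N -> (#|[set x : F | (x ^+ m == 1)%R]| <= m)%N.
Proof.
move=> m_gt0; rewrite cardE; apply: max_unity_roots m_gt0 _ (enum_uniq _).
by apply/allP => x; rewrite mem_enum inE unity_rootE.
Qed.

Lemma expf_card_pred (F : finFieldType) (x : F) : x != 0 -> x ^+ #|F|.-1 = 1.
Proof.
move=> x0; apply: (mulfI x0); rewrite mulr1 -exprS prednK ?expf_card //.
exact: ltnW (finNzRing_gt1 F).
Qed.

Lemma finField_prim_root (F : finFieldType) :
  exists z : F, #|F|.-1.-primitive_root z.
Proof.
have F_gt1 := finNzRing_gt1 F.
have /hasP[z _ zP] : has #|F|.-1.-primitive_root (enum [set~ (0 : F)]).
  apply: has_prim_root (enum_uniq _) _.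
  - by rewrite -subn1 subn_gt0.
  - apply/allP => x; rewrite mem_enum !inE => x0.
    by rewrite unity_rootE expf_card_pred.
  - by rewrite -cardE cardsC1.
by exists z.
Qed.

(** For a generator [z] and [x = z ^+ i], the condition [x ^+ M = 1] forces the gcd to divide [i],
    and by Bezout the gcd is a multiple of [r] modulo [#|F|.-1]. *)
Lemma expf_gcd_solve (F : finFieldType) (r M : nat) (x : F) :
  (gcdn #|F|.-1 r * M)%N = #|F|.-1 -> x != 0 -> x ^+ M = 1 ->
  exists2 y, y != 0 & x = y ^+ r.
Proof.
move=> defM x0 xM; have F_gt1 := finNzRing_gt1 F.
have N_gt0 : (0 < #|F|.-1)%N by rewrite -subn1 subn_gt0.
have [z zP] := finField_prim_root F.
have [i Dx] := prim_rootP zP (expf_card_pred F x x0).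
have z0 : z != 0 by apply/eqP => z0; move: (prim_expr_order zP);
  rewrite z0 expr0n gtn_eqF // => /eqP; rewrite eq_sym oner_eq0.
have : (#|F|.-1 %| i * M)%N by rewrite (prim_order_dvd zP) exprM -Dx xM.
have M_gt0 : (0 < M)%N by move: N_gt0; rewrite -defM muln_gt0 => /andP[].
rewrite -{1}defM dvdn_pmul2r // => /dvdnP[j Di].
have [r0|r_gt0] := posnP r.
  exists 1; rewrite ?oner_eq0 // r0 expr0 Dx Di r0 gcdn0 mulnC exprM.
  by rewrite (prim_expr_order zP) expr1n.
case: (egcdnP #|F|.-1 r_gt0) => u v Duv _.
exists (z ^+ (u * j)%N); first by rewrite expf_neq0.
rewrite -exprM mulnAC Duv mulnDl exprD -mulnA mulnCA exprM.
by rewrite (prim_expr_order zP) expr1n mul1r Dx Di mulnC gcdnC.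
Qed.

(** Modulo [e], the powers [q ^ a] and [q ^ b] are 1; the Bezout relation u a = v b + gcd(a, b)
    carries this over to the gcd. *)
Lemma dvdn_gcd_predX (q a b e : nat) : (0 < q)%N ->
  (e %| (q ^ a).-1)%N -> (e %| (q ^ b).-1)%N -> (e %| (q ^ gcdn a b).-1)%N.
Proof.
move=> q_gt0.
have dvdE c : (e %| (q ^ c).-1)%N = (q ^ c == 1 %[mod e])%N.
  by rewrite eqn_mod_dvd ?subn1 // expn_gt0 q_gt0.
rewrite !dvdE => /eqP qa /eqP qb.
have [->|a_gt0] := posnP a; first by rewrite gcd0n qb.
have e1 c d : (q ^ c = 1 %[mod e] -> q ^ (d * c) = 1 %[mod e])%N.
  by move=> qc; rewrite mulnC expnM -modnXm qc modnXm exp1n.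
case: (egcdnP b a_gt0) => u v Duv _; apply/eqP.
have := e1 _ u qa; rewrite Duv expnD -modnMml (e1 _ v qb) modnMml mul1n //.
Qed.

Lemma gcdn_predX (q a b : nat) : (0 < q)%N ->
  gcdn (q ^ a).-1 (q ^ b).-1 = (q ^ gcdn a b).-1.
Proof.
move=> q_gt0; apply/eqP; rewrite eqn_dvd; apply/andP; split.
  by apply: dvdn_gcd_predX; rewrite ?dvdn_gcdl ?dvdn_gcdr.
have dvdX c d : (c %| d -> (q ^ c).-1 %| (q ^ d).-1)%N.
  by move=> /dvdnP[i ->]; rewrite mulnC expnM dvdn_pred_predX.
by rewrite dvdn_gcd !dvdX ?dvdn_gcdl ?dvdn_gcdr.
Qed.

(** * The second-moment bound for pairs of cosets *)

Lemma collision_count_absurd (A B M1 M2 t c P : nat) :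
  (A * M1)%N = t.+1 -> (B * M2)%N = t.+1 ->
  (c <= (A * B).-1)%N -> (P <= t + M1.-1 * M2.-1)%N -> (t ^ 2 <= c * P)%N ->
  ~ (A * B * (A * B).-1 < t)%N.
Proof.
move=> defA defB le_c le_P CS ltD.
have le X M : (X * M = t.+1 -> (0 < X) && (X * M.-1 <= t))%N.
  by case: X M => [|X] [|M] /=; nia.
have [/andP[A_gt0 leA] /andP[B_gt0 leB]] := (le _ _ defA, le _ _ defB).
(* With D = AB this reads D P <= D t + t^2, since A(M1 - 1) and B(M2 - 1) are at most t. Together
   with t^2 <= (D - 1) P it yields t <= D(D - 1). *)
have leDP : (A * B * P <= A * B * t + t ^ 2)%N.
  apply: leq_trans (leq_mul (leqnn (A * B)%N) le_P) _.
  rewrite mulnDr leq_add2l mulnACA -mulnn; exact: leq_mul.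
have D_gt0 : (0 < A * B)%N.
  by rewrite muln_gt0 A_gt0.
move: (A * B)%N D_gt0 le_c ltD leDP => [//|D] _ /= le_c ltD leDP.
have {}CS : (t ^ 2 <= D * P)%N by apply: leq_trans CS (leq_mul _ _).
have : (D.+1 * t ^ 2 <= D * (D.+1 * t + t ^ 2))%N.
  apply: leq_trans (leq_mul (leqnn D.+1) CS) _.
  by rewrite mulnCA leq_mul2l leDP orbT.
rewrite mulSn mulnDr leq_add2r mulnA (mulnC D) -mulnn leqNgt.
by rewrite ltn_pmul2r ?ltD // (leq_ltn_trans _ ltD).
Qed.

(** As x + y >= 4, the product AB is at most xy - 3, which leaves ample room below [Q.-2]. It is
    applied to x = q^k, y = q^|d-h| and Q = q^n, where the last hypothesis is k + |d-h| <= n/2. *)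
Lemma ltn_mul_pred (x y A B Q : nat) :
  (1 < x)%N -> (1 < y)%N -> (A <= x.-1)%N -> (B <= y.-1)%N ->
  ((x * y) ^ 2 <= Q)%N -> (A * B * (A * B).-1 < Q.-2)%N.
Proof.
move=> x_gt1 y_gt1 leA leB; have := leq_mul leA leB.
have : (x.-1 * y.-1 + 3 <= x * y)%N by nia.
move: (A * B)%N (x * y)%N => D E leE leD.
have : (D + 3 <= E)%N by lia.
nia.
Qed.

(** Since A M1 = |F| - 1, the A-th powers are the kernel of the M1-th power map, so [x ^+ M1] labels
    the coset of [x]; likewise for B and M2. *)
Lemma power_cosets_meet (F : finFieldType) (A B M1 M2 : nat) (alpha beta a : F) :
  (A * M1)%N = #|F|.-1 -> (B * M2)%N = #|F|.-1 ->
  alpha != 0 -> beta != 0 -> a != 0 ->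
  (A * B * (A * B).-1 < #|F|.-2)%N ->
  exists2 x, (x != 0) && (x + beta != 0) &
    x ^+ M1 = alpha ^+ M1 /\ (x + beta) ^+ M2 = a ^+ M2.
Proof.
move=> defA defB al0 be0 a0 ltD.
pose X : {set F} := ~: [set 0; - beta].
pose f x := (x ^+ M1, (x + beta) ^+ M2).
have XP x : (x \in X) = (x != 0) && (x + beta != 0).
  by rewrite !inE negb_or addr_eq0.
case: (boolP [exists x in X, f x == (alpha ^+ M1, a ^+ M2)]) => [|noX].
  by move=> /exists_inP[x xX /eqP[? ?]]; exists x; rewrite -?XP.
have N_gt0 : (0 < #|F|.-1)%N by case: #|F|.-1 ltD; rewrite ?ltn0.
move: (N_gt0) (N_gt0); rewrite -{1}defA -{1}defB !muln_gt0.
move=> /andP[A_gt0 M1_gt0] /andP[B_gt0 M2_gt0].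
have cardX : #|X| = #|F|.-2.
  by rewrite cardsCs setCK cards2 eq_sym oppr_eq0 be0 subn2.
pose U m := [set x : F | x ^+ m == 1].
(* The labels are A-th and B-th roots of unity, and the wanted pair is assumed to be missed, hence
   the -1. *)
have cardI : (#|f @: X| <= (A * B).-1)%N.
  have cAB : (alpha ^+ M1, a ^+ M2) \in setX (U A) (U B).
    by rewrite !inE -!exprM ![(M1 * _)%N]mulnC ![(M2 * _)%N]mulnC defA defB
               !expf_card_pred ?eqxx.
  have sub : f @: X \subset setX (U A) (U B) :\ (alpha ^+ M1, a ^+ M2).
    apply/subsetP => _ /imsetP[x xX ->]; rewrite in_setD1; apply/andP; split.
      by apply: contra noX => fx; apply/exists_inP; exists x.
    move: xX; rewrite XP => /andP[x0 xb0].
    by rewrite !inE -!exprM ![(M1 * _)%N]mulnC ![(M2 * _)%N]mulnC defA defB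
               !expf_card_pred ?eqxx.
  apply: leq_trans (subset_leq_card sub) _.
  have := cardsD1 (alpha ^+ M1, a ^+ M2) (setX (U A) (U B)).
  rewrite cAB add1n cardsX => DUV.
  rewrite -ltnS prednK ?muln_gt0 ?A_gt0 // -DUV.
  by rewrite leq_mul ?card_unity_roots_le.
pose Z := [set z in setX X X | f z.1 == f z.2].
have ZP z : (z \in Z) = [&& z.1 \in X, z.2 \in X & f z.1 == f z.2].
  by rewrite andbA inE; case: z => x y; rewrite in_setX.
(* The diagonal contributes [#|F|.-2]; off it, [r] injects into pairs of roots of unity different
   from 1. *)
have cardZ : (#|Z| <= #|F|.-2 + M1.-1 * M2.-1)%N.
  rewrite -(cardsID [set z | z.1 == z.2] Z); apply: leq_add.
    rewrite -cardX -(card_imset X (f := fun x => (x, x))); last by move=> x y [].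
    apply/subset_leq_card/subsetP => -[x y] /setIP[].
    by rewrite ZP inE => /and3P[/= xX _ _] /eqP <-; apply: imset_f.
  pose r (z : F * F) := (z.1 / z.2, (z.1 + beta) / (z.2 + beta)).
  rewrite -(card_in_imset (f := r)).
    have cU m : (0 < m)%N -> (#|U m :\ 1%R| <= m.-1)%N.
      move=> m0; have := card_unity_roots_le F m m0.
      by rewrite (cardsD1 1%R) inE expr1n eqxx /=; case: m m0.
    apply: leq_trans (leq_mul (cU _ M1_gt0) (cU _ M2_gt0)).
    rewrite -cardsX; apply/subset_leq_card/subsetP => _ /imsetP[[x y] zZ ->].
    move: zZ; rewrite in_setD ZP inE !XP /= => /andP[nxy].
    case/and3P=> /andP[x0 xb0] /andP[y0 yb0] /eqP[e1 e2].
    rewrite !inE /= !expr_div_n e1 e2 !divff ?expf_neq0 // !eqxx !andbT.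
    have neq1 u v : u != v -> v != 0 -> u / v != 1 :> F.
      by move=> uv v0; apply: contra uv => /eqP/divr1_eq ->.
    by rewrite !neq1 // (inj_eq (addIr beta)).
  (* A collision (x, y) with h = x / y and k = (x + beta) / (y + beta)
     satisfies y * (h - k) = beta * (k - 1), with h != k since k != 1. *)
  have solve x y : (x, y) \in Z :\: [set z | z.1 == z.2] ->
      [/\ x = (r (x, y)).1 * y, (r (x, y)).1 - (r (x, y)).2 != 0 &
        y * ((r (x, y)).1 - (r (x, y)).2) = beta * ((r (x, y)).2 - 1)].
    rewrite in_setD ZP inE !XP /= => /andP[nxy].
    case/and3P=> /andP[x0 xb0] /andP[y0 yb0] _.
    have e : y * (x / y - (x + beta) / (y + beta)) =
             beta * ((x + beta) / (y + beta) - 1).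
      by field; rewrite y0 yb0.
    split=> //; first by rewrite divfK.
    apply: contra nxy => /eqP h; move: e; rewrite h mulr0 => /esym/eqP.
    rewrite mulf_eq0 (negPf be0) subr_eq0 /= => /eqP/divr1_eq.
    by move/addIr=> ->.
  move=> [x y] [x' y'] /solve[xE d0 yE] /solve[xE' d0' yE'] er.
  have ey : y = y' by apply: (mulIf d0); rewrite yE er -yE'.
  by rewrite xE xE' er ey.
have := sqr_card_le_collisions _ _ f X.
rewrite cardX -/Z => CS.
have DN : #|F|.-1 = (#|F|.-2).+1 by rewrite prednK //; apply: leq_ltn_trans ltD.
by case: (collision_count_absurd A B M1 M2 _ _ _ _ _ cardI cardZ CS ltD);
  rewrite -DN.
Qed.

(** * Points of the projective line and reduction to one equation *)

Lemma pt_sub (F : finFieldType) (x a y b : F) :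
  y != 0 -> a * y = b * x -> pt (x, a) \subset pt (y, b).
Proof.
move=> y0 e; apply/subsetP => _ /imsetP[c _ ->] /=.
apply/imsetP; exists (c * x / y) => //=; congr pair; first by rewrite divfK.
by apply: (mulIf y0); rewrite -(mulrA c a) e; field.
Qed.

Lemma eq_ptP (F : finFieldType) (x a y b : F) : x != 0 -> y != 0 ->
  pt (x, a) = pt (y, b) <-> a * y = b * x.
Proof.
move=> x0 y0; split=> [e|e]; last first.
  by apply/eqP; rewrite eqEsubset !pt_sub.
have /imsetP[c _ /= [-> ->]] : (x, a) \in pt (y, b).
  by rewrite -e; apply/imsetP; exists 1; rewrite //= !mul1r.
by rewrite -mulrA mulrCA mulrA.
Qed.

Lemma expr_predX (F : fieldType) (Y : F) (r : nat) :
  (0 < r)%N -> Y != 0 -> Y ^+ r / Y = Y ^+ r.-1.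
Proof. by case: r => // r _ Y0; rewrite exprSr mulfK. Qed.

(** Take z = y^(q^h) if h <= d, and z = 1 / y^(q^d) otherwise. Every nonzero z arises so, because
    the q^(n-c)-th power map inverts the q^c-th one on F. *)
Lemma frobenius_ratioP (F : finFieldType) (q n d h : nat) (v : F) :
  (0 < q)%N -> #|F| = (q ^ n)%N -> (d < n)%N -> (h < n)%N ->
  (exists2 y, y != 0 & v = y ^+ (q ^ d) / y ^+ (q ^ h)) <->
  (exists2 z, z != 0 & v = z ^+ (q ^ absdiff d h).-1).
Proof.
move=> q_gt0 hF dn hn; rewrite /absdiff.
have surj c z : (c < n)%N -> (z ^+ (q ^ (n - c))) ^+ (q ^ c) = z :> F.
  by move=> cn; rewrite -exprM -expnD subnK ?(ltnW cn) // -hF expf_card.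
have q0 c : (0 < q ^ c)%N by rewrite expn_gt0 q_gt0.
have [hd|/ltnW dh] := leqP h d.
  rewrite (eqP hd) addn0.
  have e y : y != 0 -> y ^+ (q ^ d) / y ^+ (q ^ h) =
      (y ^+ (q ^ h)) ^+ (q ^ (d - h)).-1 :> F.
    move=> y0; rewrite -expr_predX ?expf_neq0 //.
    by rewrite -[X in _ = X / _]exprM -expnD subnKC.
  split=> [[y y0 ->]|[z z0 ->]]; first by exists (y ^+ (q ^ h)); rewrite ?expf_neq0 ?e.
  by exists (z ^+ (q ^ (n - h))); rewrite ?e ?surj ?expf_neq0.
rewrite (eqP dh) add0n.
have e y : y != 0 -> y ^+ (q ^ d) / y ^+ (q ^ h) =
    (y ^+ (q ^ d))^-1 ^+ (q ^ (h - d)).-1 :> F.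
  move=> y0; rewrite exprVn -expr_predX ?expf_neq0 //.
  by rewrite -[X in _ = (X / _)^-1]exprM -expnD subnKC // invf_div.
split=> [[y y0 ->]|[z z0 ->]].
  by exists (y ^+ (q ^ d))^-1; rewrite ?invr_eq0 ?expf_neq0 ?e.
by exists (z^-1 ^+ (q ^ (n - d))); rewrite ?e ?surj ?expf_neq0 ?invr_eq0 ?invrK.
Qed.

(** Two points with nonzero first coordinates agree exactly when their slopes do; the slope on the
    [Lf] side is [ad] times a Frobenius ratio. *)
Lemma meet_iff (F : finFieldType) (q n k d h : nat) (alpha beta ad : F) :
  (0 < q)%N -> #|F| = (q ^ n)%N -> (d < n)%N -> (h < n)%N ->
  Lg (fun x => alpha * x ^+ (q ^ k) + beta * x) :&:
    Lf q h (fun y => ad * y ^+ (q ^ d)) != set0 <->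
  exists u z : F, [/\ u != 0, z != 0 &
    alpha * u ^+ (q ^ k).-1 + beta = ad * z ^+ (q ^ absdiff d h).-1].
Proof.
move=> q_gt0 hF dn hn.
have e u : u != 0 -> alpha * u ^+ (q ^ k).-1 + beta =
    (alpha * u ^+ (q ^ k) + beta * u) / u.
  by move=> u0; rewrite -expr_predX ?expn_gt0 ?q_gt0 //; field.
split.
  case/set0Pn => _ /setIP[/imsetP[x x0 ->] /imsetP[y y0]].
  rewrite !inE in x0 y0; move/(eq_ptP _ _ _ _ _ x0 (expf_neq0 _ y0)) => exy.
  have [|z z0 zE] := (frobenius_ratioP F q n d h (y ^+ (q ^ d) / y ^+ (q ^ h))
    q_gt0 hF dn hn).1; first by exists y.
  exists x, z; split=> //; rewrite e // -zE mulrA.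
  by apply/eqP; rewrite eqr_div ?expf_neq0 // exy.
case=> u [z [u0 z0 uz]].
have [|y y0 yE] := (frobenius_ratioP F q n d h (z ^+ (q ^ absdiff d h).-1)
    q_gt0 hF dn hn).2; first by exists z.
apply/set0Pn; exists (pt (u, alpha * u ^+ (q ^ k) + beta * u)).
apply/setIP; split; apply/imsetP; first by exists u.
exists y => //; apply/(eq_ptP _ _ _ _ _ u0 (expf_neq0 _ y0))/eqP.
by rewrite -eqr_div ?expf_neq0 // -e // uz yE mulrA.
Qed.

Theorem theorem3p9 (F : finFieldType) (p m q n : nat)
  (hp : prime p) (hm : (0 < m)%N) (hq : q = (p ^ m)%N) (hn : (2 <= n)%N)
  (hF : #|F| = (q ^ n)%N)
  (alpha beta ad : F) (k d h : nat)
  (halpha : alpha != 0) (hk1 : (1 <= k)%N) (hkn : (k < n)%N)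
  (had : ad != 0) (hdn : (d < n)%N) (hhn : (h < n)%N) (hhd : h != d) :
  let g := fun x : F => alpha * x ^+ (q ^ k)%N + beta * x in
  let f := fun y : F => ad * y ^+ (q ^ d)%N in
  (beta = 0 ->
     (Lg g :&: Lf q h f != set0 <->
      normqn q n (gcdn n (gcdn k (absdiff d h))) (ad / alpha) = 1)) /\
  (beta != 0 -> (2 * (k + absdiff d h) <= n)%N ->
     Lg g :&: Lf q h f != set0).
Proof.
have q_gt1 : (1 < q)%N by rewrite hq -(exp1n m) ltn_exp2r ?prime_gt1.
have q_gt0 := ltnW q_gt1.
have s_gt0 : (0 < absdiff d h)%N.
  by rewrite addn_gt0 !subn_gt0 -neq_ltn.
have prod_div c : (gcdn #|F|.-1 c * (#|F|.-1 %/ gcdn #|F|.-1 c))%N = #|F|.-1.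
  by rewrite mulnC divnK ?dvdn_gcdl.
have pred_gt0 c : (0 < c)%N -> (0 < (q ^ c).-1)%N.
  by move=> c_gt0; rewrite -subn1 subn_gt0 -(exp1n c) ltn_exp2r.
have meet := meet_iff F q n k d h alpha beta ad q_gt0 hF hdn hhn.
move=> g f; split=> [beta0|beta0 le_n].
  (* The norm exponent becomes M = (|F| - 1) / gcd(|F| - 1, r, s), so that M-th powers kill all r-th
     and s-th powers. *)
  apply: (iff_trans meet); rewrite /normqn -!gcdn_predX // -hF.
  set r := (q ^ k).-1; set s := (q ^ _).-1; set M := (_ %/ _)%N.
  have defM := prod_div (gcdn r s); rewrite -/M in defM.
  split=> [[u [z [u0 z0 uz]]]|norm1].
    have expM c (w : F) : (gcdn r s %| c)%N -> w != 0 -> w ^+ c ^+ M = 1.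
      move=> /(dvdn_trans (dvdn_gcdr #|F|.-1 _))/dvdnP[i ->] w0.
      by rewrite -exprM -mulnA defM mulnC exprM expf_card_pred ?expr1n.
    have -> : ad / alpha = u ^+ r / z ^+ s.
      apply/eqP; rewrite eqr_div ?expf_neq0 // -uz beta0 addr0; apply/eqP; ring.
    by rewrite expr_div_n !expM ?divr1 ?dvdn_gcdl ?dvdn_gcdr.
  have a0 : ad / alpha != 0 by rewrite mulf_neq0 ?invr_eq0.
  have [w w0 wE] := expf_gcd_solve F (gcdn r s) M _ defM a0 norm1.
  (* Bezout, i r = j s + gcd(r, s), splits the gcd-th power of [w] into a quotient of an r-th and an
     s-th power. *)
  case: (egcdnP s (pred_gt0 k hk1)) => i j ij _.
  exists (w ^+ i), (w ^+ j); rewrite !expf_neq0 //; split=> //.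
  rewrite beta0 addr0 -!exprM ij exprD -wE; field.
  exact: halpha.
apply/meet.
set r := (q ^ k).-1; set s := (q ^ _).-1.
(* The r-th powers have index gcd(|F| - 1, r) <= r in F^*, and similarly for s. An [x] with x /
   alpha an r-th power and (x + beta) / ad an s-th power solves the equation. *)
have [||||x /andP[x0 xb0] [xa xb]] := power_cosets_meet F _ _ _ _
  alpha beta ad (prod_div r) (prod_div s) => //.
  rewrite hF; apply: (ltn_mul_pred (q ^ k) (q ^ absdiff d h)).
  - by rewrite (leq_trans q_gt1) // -{1}(expn1 q) leq_pexp2l.
  - by rewrite (leq_trans q_gt1) // -{1}(expn1 q) leq_pexp2l.
  - by rewrite dvdn_leq ?dvdn_gcdr ?pred_gt0.
  - by rewrite dvdn_leq ?dvdn_gcdr ?pred_gt0.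
  - by rewrite -expnD -expnM leq_pexp2l // mulnC.
have [||u u0 uE] := expf_gcd_solve F r _ (x / alpha) (prod_div r).
- by rewrite mulf_neq0 ?invr_eq0.
- by rewrite expr_div_n xa divff ?expf_neq0.
have [||z z0 zE] := expf_gcd_solve F s _ ((x + beta) / ad) (prod_div s).
- by rewrite mulf_neq0 ?invr_eq0.
- by rewrite expr_div_n xb divff ?expf_neq0.
exists u, z; split=> //; rewrite -uE -zE.
by field; apply/andP.
Qed.
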